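(* Let $X$ and $Y$ be Banach spaces over $\mathbb{K}$ ($=\mathbb{R}$ or $\mathbb{C}$) and suppose that $n(X)=1$. If $X\oplus_1 Y$ has the weak BPBp-nu with a function $\eta$, then the pair $(X,Y)$ has the BPBZp with the function $\gamma(\varepsilon)=\eta\left(\frac{\varepsilon}{4+\varepsilon}\right)$ for $0<\varepsilon<1$.
   Context: $S_X$ is the unit sphere of a Banach space $X$, $X^*$ its topological dual, $\mathcal{L}(X,Y)$ the bounded linear operators from $X$ to $Y$, $\mathcal{L}(X)=\mathcal{L}(X,X)$. $X\oplus_1 Y$ is $X\times Y$ with norm $\|x\|+\|y\|$. Let $\Pi(X)=\{(x,x^* )\in S_X\times S_{X^*}: x^*(x)=1\}$; for $T\in\mathcal{L}(X)$ the numerical radius is $\nu(T)=\sup\{|x^*(Tx)|:(x,x^* )\in\Pi(X)\}$, and the numerical index of $X$ is $n(X)=\inf\{\nu(T):T\in\mathcal{L}(X),\ \|T\|=1\}$. Weak BPBp-nu: a Banach space $Z$ has the weak BPBp-nu with a function $\eta$ if for every $0<\varepsilon<1$ one has $\eta(\varepsilon)>0$ and, whenever $T\in\mathcal{L}(Z)$ and $(z_0,z_0^* )\in\Pi(Z)$ satisfy $\nu(T)=1$ and $|z_0^*(Tz_0)|>1-\eta(\varepsilon)$, there exist $S\in\mathcal{L}(Z)$ and $(z_1,z_1^* )\in\Pi(Z)$ such that $\nu(S)=|z_1^*(Sz_1)|$, $\|S-T\|<\varepsilon$, $\|z_1-z_0\|<\varepsilon$ and $\|z_1^*-z_0^*\|<\varepsilon$.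 BPBZp: the pair $(X,Y)$ has the BPBZp with the function $\gamma$ (for $0<\varepsilon<1$) if for each such $\varepsilon$ one has $\gamma(\varepsilon)>0$ and, whenever $T\in\mathcal{L}(X,Y)$ with $\|T\|=1$, $y_0^*\in S_{Y^*}$ and $x_0\in S_X$ satisfy $|y_0^*(Tx_0)|>1-\gamma(\varepsilon)$, there exist $y_1^*\in S_{Y^*}$, $x_1\in S_X$ and $S\in\mathcal{L}(X,Y)$ with $\|S\|=|y_1^*(Sx_1)|=1$, $\|x_1-x_0\|<\varepsilon$, $\|y_1^*-y_0^*\|<\varepsilon$ and $\|S-T\|<\varepsilon$. *)

(* Defs.v *)
From Stdlib Require Import Reals Lra.
From Coquelicot Require Import Coquelicot.

Set Implicit Arguments.
Unset Strict Implicit.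
Unset Printing Implicit Defensive.

Open Scope R_scope.

(* Banach spaces over K are the [CompleteNormedModule]s over K = R_AbsRing or
   K = C_AbsRing; the norm is real-valued in both cases.  Bounded linear
   operators are functions satisfying Coquelicot's [is_linear], which includes
   boundedness.  [AbsRing_NormedModule K] is K as a normed space over itself,
   with norm the absolute value. *)

Section L1Norm.

Variables (K : AbsRing) (X Y : NormedModule K).

Definition l1_norm (z : X * Y) : R := norm (fst z) + norm (snd z).

Lemma l1_norm_triangle (z w : X * Y) :
  l1_norm (plus z w) <= l1_norm z + l1_norm w.
Proof.
assert (Hx := norm_triangle (fst z) (fst w)).
assert (Hy := norm_triangle (snd z) (snd w)).
unfold l1_norm; simpl; lra.
Qed.

Lemma l1_norm_scal (k : K) (z : X * Y) :
  l1_norm (scal k z) <= abs k * l1_norm z.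
Proof.
assert (Hx := norm_scal k (fst z)).
assert (Hy := norm_scal k (snd z)).
unfold l1_norm; simpl; lra.
Qed.

Lemma l1_norm_compat1 (z w : X * Y) (eps : R) :
  l1_norm (minus w z) < eps -> ball z eps w.
Proof.
destruct z as [x y], w as [x' y']; intros H.
change (norm (minus x' x) + norm (minus y' y) < eps) in H.
assert (Hx := norm_ge_0 (minus x' x)).
assert (Hy := norm_ge_0 (minus y' y)).
split; [apply (norm_compat1 x x') | apply (norm_compat1 y y')]; lra.
Qed.

Lemma l1_norm_compat2 (z w : X * Y) (eps : posreal) :
  ball z eps w ->
  l1_norm (minus w z) < (@norm_factor K X + @norm_factor K Y) * eps.
Proof.
intros [H1 H2]; rewrite Rmult_plus_distr_r.
exact (Rplus_lt_compat _ _ _ _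
         (norm_compat2 _ _ _ H1) (norm_compat2 _ _ _ H2)).
Qed.

Lemma l1_norm_eq_zero (z : X * Y) : l1_norm z = 0 -> z = zero.
Proof.
destruct z as [x y]; unfold l1_norm; simpl; intros H.
assert (Hx := norm_ge_0 x); assert (Hy := norm_ge_0 y).
apply (f_equal2 pair); apply norm_eq_zero; lra.
Qed.

Definition l1_NormedModule_mixin :
    NormedModule.mixin_of K (prod_NormedModuleAux K X Y) :=
  @NormedModule.Mixin K (prod_NormedModuleAux K X Y) l1_norm
    (@norm_factor K X + @norm_factor K Y) l1_norm_triangle l1_norm_scal
    l1_norm_compat1 l1_norm_compat2 l1_norm_eq_zero.

End L1Norm.

Section L1Sum.

Variables (K : AbsRing) (X Y : CompleteNormedModule K).

Definition l1_lim (F : ((X * Y) -> Prop) -> Prop) : X * Y :=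
  (lim (fun P : X -> Prop => F (fun z => P (fst z))),
   lim (fun P : Y -> Prop => F (fun z => P (snd z)))).

Lemma l1_complete_cauchy (F : (prod_UniformSpace X Y -> Prop) -> Prop) :
  ProperFilter F -> cauchy F -> forall eps : posreal, F (ball (l1_lim F) eps).
Proof.
intros FF HF eps; apply filter_and.
- apply (complete_cauchy (fun P : X -> Prop => F (fun z => P (fst z)))).
  + exact (filtermap_proper_filter _ _ (fun z : X * Y => fst z) F FF).
  + intros e; destruct (HF e) as [z Hz]; exists (fst z).
    revert Hz; apply filter_imp; intros w Hw; exact (proj1 Hw).
- apply (complete_cauchy (fun P : Y -> Prop => F (fun z => P (snd z)))).
  + exact (filtermap_proper_filter _ _ (fun z : X * Y => snd z) F FF).
  + intros e; destruct (HF e) as [z Hz]; exists (snd z).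
    revert Hz; apply filter_imp; intros w Hw; exact (proj2 Hw).
Qed.

Lemma l1_close_lim (F1 F2 : (prod_UniformSpace X Y -> Prop) -> Prop) :
  filter_le F1 F2 -> filter_le F2 F1 -> close (l1_lim F1) (l1_lim F2).
Proof.
intros H1 H2 eps; split.
- refine (close_lim _ _ _ _ eps); intros P; [exact (H1 _) | exact (H2 _)].
- refine (close_lim _ _ _ _ eps); intros P; [exact (H1 _) | exact (H2 _)].
Qed.

(* The l1-sum of X and Y.  It is deliberately not a canonical structure on
   X * Y: Coquelicot's canonical norm there is the Euclidean one. *)
Definition l1_sum : CompleteNormedModule K :=
  CompleteNormedModule.Pack K (X * Y)
    (CompleteNormedModule.Class K (X * Y)
       (NormedModule.Class K (X * Y)
          (NormedModuleAux.class K (prod_NormedModuleAux K X Y))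
          (l1_NormedModule_mixin X Y))
       (CompleteSpace.Mixin (prod_UniformSpace X Y) l1_lim
          l1_complete_cauchy l1_close_lim))
    (X * Y).

Lemma l1_sum_normE (z : l1_sum) : norm z = norm (fst z) + norm (snd z).
Proof. reflexivity. Qed.

Lemma l1_sum_plusE (z w : l1_sum) :
  plus z w = (plus (fst z) (fst w), plus (snd z) (snd w)).
Proof. reflexivity. Qed.

Lemma l1_sum_scalE (k : K) (z : l1_sum) :
  scal k z = (scal k (fst z), scal k (snd z)).
Proof. reflexivity. Qed.

End L1Sum.

Arguments l1_sum {K} X Y.

(* [real] sends the infinite elements of Rbar to 0.  For a bounded linear T
   the supremum below is finite, since the set contains 0 and is bounded. *)
Definition op_norm {K : AbsRing} {U V : NormedModule K} (T : U -> V) : R :=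
  real (Lub_Rbar (fun r => exists x : U, norm x <= 1 /\ r = norm (T x))).

Definition unit_sphere {K : AbsRing} {U : NormedModule K} (x : U) : Prop :=
  norm x = 1.

Definition dual_norm {K : AbsRing} {U : NormedModule K} (f : U -> K) : R :=
  @op_norm K U (AbsRing_NormedModule K) f.

Definition dual_unit_sphere {K : AbsRing} {U : NormedModule K} (f : U -> K) :
    Prop :=
  @is_linear K U (AbsRing_NormedModule K) f /\ dual_norm f = 1.

Definition states {K : AbsRing} {U : NormedModule K} (x : U) (f : U -> K) :
    Prop :=
  unit_sphere x /\ dual_unit_sphere f /\ f x = one.

(* The value is 0 when U = {0}, where no state exists. *)
Definition numerical_radius {K : AbsRing} {U : NormedModule K} (T : U -> U) :
    R :=
  real (Lub_Rbar (fun r => exists (x : U) (f : U -> K),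
    states x f /\ r = abs (f (T x)))).

(* The set is bounded below by 0.  It is empty only for U = {0}, where the
   infimum is +oo and the value is 0. *)
Definition numerical_index {K : AbsRing} (U : NormedModule K) : R :=
  real (Glb_Rbar (fun r => exists T : U -> U,
    is_linear T /\ op_norm T = 1 /\ r = numerical_radius T)).

Definition weak_BPBp_nu {K : AbsRing} (Z : CompleteNormedModule K)
    (eta : R -> R) : Prop :=
  forall eps : R, 0 < eps < 1 ->
  0 < eta eps /\
  forall (T : Z -> Z) (z0 : Z) (f0 : Z -> K),
    is_linear T -> states z0 f0 ->
    numerical_radius T = 1 ->
    abs (f0 (T z0)) > 1 - eta eps ->
  exists (S : Z -> Z) (z1 : Z) (f1 : Z -> K),
    is_linear S /\ states z1 f1 /\
    numerical_radius S = abs (f1 (S z1)) /\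
    op_norm (fun z => minus (S z) (T z)) < eps /\
    norm (minus z1 z0) < eps /\
    dual_norm (fun z => minus (f1 z) (f0 z)) < eps.

Definition BPBZp {K : AbsRing} (X Y : CompleteNormedModule K)
    (gamma : R -> R) : Prop :=
  forall eps : R, 0 < eps < 1 ->
  0 < gamma eps /\
  forall (T : X -> Y) (g0 : Y -> K) (x0 : X),
    is_linear T -> op_norm T = 1 ->
    dual_unit_sphere g0 -> unit_sphere x0 ->
    abs (g0 (T x0)) > 1 - gamma eps ->
  exists (g1 : Y -> K) (x1 : X) (S : X -> Y),
    dual_unit_sphere g1 /\ unit_sphere x1 /\ is_linear S /\
    op_norm S = 1 /\ abs (g1 (S x1)) = 1 /\
    norm (minus x1 x0) < eps /\
    dual_norm (fun y => minus (g1 y) (g0 y)) < eps /\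
    op_norm (fun x => minus (S x) (T x)) < eps.

(* Main.v *)
(* Lift [T : X -> Y] to [(x, y) |-> (0, T x)] on the l1-sum; its numerical
   radius is [op_norm T] by Hahn-Banach.  The weak BPBp-nu gives a nearby [S]
   attaining its numerical radius [nu] at some ((x1, y1), (f, g)); by convexity
   it also attains it at ((a, 0), (f, g)) with [a = x1 / norm x1].  Write
   [S (x, 0) = (BX x, BY x)].  Since [n(X) = 1],
     |f (BX x)| + norm (BY x) <= nu * norm x   for all x,
   with equality at [a], so [g] attains its norm at the direction [y] of
   [BY a].  Then [U x = BY x + f (BX x) u y], with a suitable phase [u], has
   norm [nu = |g (U a)|], and [U / nu] is the required operator. *)
Require Import Defs.
From Stdlib Require Import Reals Lra.
From Coquelicot Require Import Coquelicot.
From Corelib Require Import ssreflect.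
From mathcomp Require boolp classical_sets.
Open Scope R_scope.

(** * Hahn-Banach over the real numbers *)

(** The lift takes values in [Y], so the perturbed operator must be brought back to one from [X] to
    [Y]. Dropping [BX] is not enough: [norm (BY a)] is [nu - |f (BX a)|], while [BY] may be larger
    elsewhere on the sphere, so it need not attain its norm at [a]. Adding [f (BX x)] along [y]
    restores the missing mass at [a], and the inequality drawn from [n(X) = 1] is exactly what keeps
    the sum below [nu] everywhere else. The errors stay small because the [X]- and [Y]-parts of the
    error of [S] at [(x, 0)] add up in the l1 norm: [U] is as close to [T] as [S] is to the lift.
    Dividing by [nu] costs at most the same amount again, so with [d = eps / (4 + eps)] the total is
    below [2 * d < eps]. *)

Lemma Lub_Rbar_finite (E : R -> Prop) (a b : R) :
  E a -> (forall r, E r -> r <= b) ->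
  is_lub_Rbar E (Finite (real (Lub_Rbar E))).
Proof.
intros Ha Hb; generalize (Lub_Rbar_correct E).
destruct (Lub_Rbar E) as [l | |]; intros [H1 H2]; simpl in *.
- split; assumption.
- elim (H2 (Finite b)); intros r Hr; exact (Hb r Hr).
- elim (H1 a Ha).
Qed.

Lemma Glb_Rbar_finite (E : R -> Prop) (a b : R) :
  E a -> (forall r, E r -> b <= r) ->
  is_glb_Rbar E (Finite (real (Glb_Rbar E))).
Proof.
intros Ha Hb; generalize (Glb_Rbar_correct E).
destruct (Glb_Rbar E) as [l | |]; intros [H1 H2]; simpl in *.
- split; assumption.
- elim (H1 a Ha).
- elim (H2 (Finite b)); intros r Hr; exact (Hb r Hr).
Qed.

Lemma Rle_Rmult_of_Rinv (r a b : R) : 0 < r -> / r * a <= b -> a <= r * b.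
Proof.
intros Hr H; apply (Rmult_le_compat_l r) in H; [| lra].
replace (r * (/ r * a)) with a in H by (field; lra); exact H.
Qed.

Lemma plus_plus_swap {G : AbelianMonoid} (a b c d : G) :
  plus (plus a b) (plus c d) = plus (plus a c) (plus b d).
Proof.
now rewrite -!plus_assoc (plus_assoc b c d) (plus_comm b c) -(plus_assoc c b d).
Qed.

Section HahnBanach.

Variable V : ModuleSpace R_Ring.

(** Homogeneity is only an inequality for [r > 0], which is easy to check for infima; equality
    follows by scaling back with [/ r]. *)
Definition sublinear (p : V -> R) : Prop :=
  (forall u v, p (plus u v) <= p u + p v) /\
  (forall r u, 0 < r -> p (scal r u) <= r * p u).

Lemma sublinear_zero (p : V -> R) : sublinear p -> p zero = 0.
Proof.
intros [_ H].
assert (H1 := H 2 zero ltac:(lra)); rewrite scal_zero_r in H1.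
assert (H2 := H (/2) zero ltac:(lra)); rewrite scal_zero_r in H2.
lra.
Qed.

Lemma sublinear_opp (p : V -> R) (u : V) : sublinear p -> - p (opp u) <= p u.
Proof.
intros Hp; assert (H := proj1 Hp u (opp u)).
rewrite plus_opp_r (sublinear_zero p Hp) in H; lra.
Qed.

Lemma sublinear_scal (p : V -> R) (r : R) (u : V) :
  sublinear p -> 0 <= r -> p (scal r u) = r * p u.
Proof.
intros Hp [Hr | <-].
- apply Rle_antisym; [now apply Hp |].
  assert (Hr' : 0 < / r) by now apply Rinv_0_lt_compat.
  assert (H := proj2 Hp (/ r) (scal r u) Hr').
  rewrite scal_assoc in H.
  replace (mult (/ r) r) with (one : R_Ring) in H.
  + rewrite scal_one in H.
    apply (Rmult_le_compat_l r) in H; [| lra].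
    replace (r * (/ r * p (scal r u))) with (p (scal r u)) in H by (field; lra).
    exact H.
  + change (1 = / r * r); field; lra.
- replace (scal 0 u) with (zero : V) by (symmetry; exact (scal_zero_l u)).
  rewrite (sublinear_zero p Hp); ring.
Qed.

(* The largest sublinear minorant of [p] that is at most [- p v] at [- v]. *)
Definition tilt (p : V -> R) (v u : V) : R :=
  real (Glb_Rbar (fun r => exists t, 0 <= t /\
    r = p (plus u (scal t v)) - t * p v)).

Lemma tilt_glb (p : V -> R) (v u : V) : sublinear p ->
  is_glb_Rbar (fun r => exists t, 0 <= t /\
    r = p (plus u (scal t v)) - t * p v) (Finite (tilt p v u)).
Proof.
intros Hp.
apply (Glb_Rbar_finite _ (p (plus u (scal 0 v)) - 0 * p v) (- p (opp u))).
- exists 0; split; [lra | reflexivity].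
- intros r [t [Ht ->]].
  (* Lower bound from [t * p v = p (t v) <= p (- u) + p (u + t v)]. *)
  assert (H := proj1 Hp (opp u) (plus u (scal t v))).
  rewrite plus_assoc plus_opp_l plus_zero_l (sublinear_scal p t v Hp Ht) in H.
  lra.
Qed.

Lemma tilt_le (p : V -> R) (v u : V) (t : R) : sublinear p -> 0 <= t ->
  tilt p v u <= p (plus u (scal t v)) - t * p v.
Proof.
intros Hp Ht; apply (proj1 (tilt_glb p v u Hp)).
exists t; split; [exact Ht | reflexivity].
Qed.

Lemma tilt_ge (p : V -> R) (v u : V) (b : R) : sublinear p ->
  (forall t, 0 <= t -> b <= p (plus u (scal t v)) - t * p v) ->
  b <= tilt p v u.
Proof.
intros Hp Hb; apply (proj2 (tilt_glb p v u Hp) (Finite b)).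
intros r [t [Ht ->]]; exact (Hb t Ht).
Qed.

Lemma tilt_minorant (p : V -> R) (v u : V) : sublinear p -> tilt p v u <= p u.
Proof.
intros Hp; assert (H := tilt_le p v u 0 Hp (Rle_refl 0)).
replace (scal 0 v) with (zero : V) in H by (symmetry; exact (scal_zero_l v)).
rewrite plus_zero_r in H; lra.
Qed.

(** Parameters [t] for [u] and [s] for [w] combine to [t + s] for the sum, and [t] for [u] becomes
    [r * t] for [scal r u]. *)
Lemma tilt_sublinear (p : V -> R) (v : V) : sublinear p -> sublinear (tilt p v).
Proof.
intros Hp; split.
- intros u w.
  enough (tilt p v (plus u w) - tilt p v u <= tilt p v w) by lra.
  apply tilt_ge; [exact Hp |]; intros s Hs.
  enough (tilt p v (plus u w) - (p (plus w (scal s v)) - s * p v)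
          <= tilt p v u) by lra.
  apply tilt_ge; [exact Hp |]; intros t Ht.
  assert (H := tilt_le p v (plus u w) (t + s) Hp ltac:(lra)).
  assert (H' := proj1 Hp (plus u (scal t v)) (plus w (scal s v))).
  rewrite plus_plus_swap -scal_distr_r in H'.
  change (p (plus (plus u w) (scal (t + s) v))
          <= p (plus u (scal t v)) + p (plus w (scal s v))) in H'.
  lra.
- intros r u Hr.
  enough (H : / r * tilt p v (scal r u) <= tilt p v u).
  { exact (Rle_Rmult_of_Rinv r _ _ Hr H). }
  apply tilt_ge; [exact Hp |]; intros t Ht.
  assert (H0 : 0 <= r * t) by (apply Rmult_le_pos; lra).
  assert (H := tilt_le p v (scal r u) (r * t) Hp H0).
  replace (scal (r * t) v) with (scal r (scal t v)) in H
    by exact (scal_assoc r t v).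
  rewrite -scal_distr_l (sublinear_scal p r _ Hp (Rlt_le _ _ Hr)) in H.
  apply (Rmult_le_compat_l (/ r)) in H;
    [| apply Rlt_le, Rinv_0_lt_compat; exact Hr].
  apply (Rle_trans _ _ _ H), Req_le; field; lra.
Qed.

(** Zorn's lemma for the reversed pointwise order. The bound of a chain is its pointwise infimum,
    finite because every member is at least [- N (- u)]. *)
Lemma minimal_sublinear (N : V -> R) : sublinear N ->
  exists p, sublinear p /\ (forall u, p u <= N u) /\
    forall q, sublinear q -> (forall u, q u <= p u) -> forall u, p u <= q u.
Proof.
intros HN.
pose (T := {p : V -> R | sublinear p /\ forall u, p u <= N u}).
pose (le_T := fun p q : T => boolp.asbool
  (forall u, proj1_sig q u <= proj1_sig p u)).
assert (le_TP : forall p q, ssrbool.reflect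
  (forall u, proj1_sig q u <= proj1_sig p u) (le_T p q))
  by (intros; apply boolp.asboolP).
pose (N0 := exist _ N (conj HN (fun u => Rle_refl (N u))) : T).
destruct (@classical_sets.ZL_preorder T N0 le_T) as [[p [Hp HpN]] Hmin].
- intros p; apply (ssrbool.introT (le_TP p p)); intros u; lra.
- intros q p r H1 H2; apply (ssrbool.introT (le_TP _ _)); intros u.
  assert (H3 := ssrbool.elimT (le_TP _ _) H1 u).
  assert (H4 := ssrbool.elimT (le_TP _ _) H2 u); lra.
- intros A HA.
  destruct (boolp.pselect (exists p, A p)) as [[p0 Hp0] | HA0].
  2: { exists N0; intros p Hp; elim HA0; now exists p. }
  pose (E := fun u r => exists p : T, A p /\ r = proj1_sig p u).
  pose (m := fun u => real (Glb_Rbar (E u))).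
  assert (Hm : forall u, is_glb_Rbar (E u) (Finite (m u))).
  { intros u; apply (Glb_Rbar_finite _ (proj1_sig p0 u) (- N (opp u))).
    - now exists p0.
    - intros r [[p [Hp HpN]] [_ ->]]; simpl.
      assert (H1 := sublinear_opp p u Hp); assert (H2 := HpN (opp u)); lra. }
  assert (m_le : forall p u, A p -> m u <= proj1_sig p u).
  { intros p u Hp; apply (proj1 (Hm u)); now exists p. }
  assert (m_ge : forall u b, (forall p, A p -> b <= proj1_sig p u) -> b <= m u).
  { intros u b Hb; apply (proj2 (Hm u) (Finite b)).
    intros r [p [Hp ->]]; exact (Hb p Hp). }
  assert (m_sub : sublinear m).
  { split.
    - intros u v; enough (m (plus u v) - m u <= m v) by lra.
      apply m_ge; intros p Hp.
      enough (m (plus u v) - proj1_sig p v <= m u) by lra.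
      apply m_ge; intros q Hq.
      (* The infimum is subadditive because [p] and [q] are comparable: the smaller of the two
         serves at both [u] and [v]. *)
      destruct (HA p q Hp Hq) as [H | H].
      + assert (H1 := m_le q (plus u v) Hq).
        assert (H2 := proj1 (proj1 (proj2_sig q)) u v).
        assert (H3 := ssrbool.elimT (le_TP _ _) H v); lra.
      + assert (H1 := m_le p (plus u v) Hp).
        assert (H2 := proj1 (proj1 (proj2_sig p)) u v).
        assert (H3 := ssrbool.elimT (le_TP _ _) H u); lra.
    - intros r u Hr.
      enough (H : / r * m (scal r u) <= m u).
      { exact (Rle_Rmult_of_Rinv r _ _ Hr H). }
      apply m_ge; intros p Hp.
      assert (H1 := m_le p (scal r u) Hp).
      assert (H2 := proj2 (proj1 (proj2_sig p)) r u Hr).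
      apply (Rmult_le_reg_l r); [exact Hr |].
      replace (r * (/ r * m (scal r u))) with (m (scal r u)) by (field; lra).
      lra. }
  assert (m_N : forall u, m u <= N u).
  { intros u; apply (Rle_trans _ _ _ (m_le p0 u Hp0)).
    exact (proj2 (proj2_sig p0) u). }
  exists (exist _ m (conj m_sub m_N)); intros p Hp.
  apply (ssrbool.introT (le_TP _ _)); intros u; exact (m_le p u Hp).
- exists p; split; [exact Hp | split; [exact HpN |]]; intros q Hq Hqp.
  assert (HqN : forall u, q u <= N u).
  { intros u; exact (Rle_trans _ _ _ (Hqp u) (HpN u)). }
  pose (q' := exist _ q (conj Hq HqN) : T).
  pose (p' := exist _ p (conj Hp HpN) : T).
  exact (ssrbool.elimT (le_TP q' p') (Hmin q' (ssrbool.introT (le_TP p' q') Hqp))).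
Qed.

(* A minimal sublinear functional coincides with its tilts, which makes it
   additive; tilting [N] along [x] beforehand forces the value at [x]. *)
Theorem hahn_banach (N : V -> R) (x : V) : sublinear N ->
  exists p : V -> R,
    (forall u v, p (plus u v) = p u + p v) /\
    (forall r u, p (scal r u) = r * p u) /\
    (forall u, p u <= N u) /\ p x = N x.
Proof.
intros HN.
destruct (minimal_sublinear (tilt N x) (tilt_sublinear N x HN))
  as [p [Hp [HpN Hmin]]].
assert (p_N : forall u, p u <= N u).
{ intros u; exact (Rle_trans _ _ _ (HpN u) (tilt_minorant N x u HN)). }
assert (p_plus : forall u v, p (plus u v) = p u + p v).
{ intros u v; apply Rle_antisym; [now apply Hp |].
  assert (H1 := Hmin (tilt p v) (tilt_sublinear p v Hp)
    (fun w => tilt_minorant p v w Hp) u).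
  assert (H2 := tilt_le p v u 1 Hp Rle_0_1).
  replace (scal 1 v) with v in H2 by (symmetry; exact (scal_one v)).
  lra. }
assert (p_opp : forall u, p (opp u) = - p u).
{ intros u; assert (H := p_plus u (opp u)).
  rewrite plus_opp_r (sublinear_zero p Hp) in H; lra. }
exists p; split; [exact p_plus | split; [| split; [exact p_N |]]].
- intros r u; destruct (Rle_or_lt 0 r) as [Hr | Hr].
  + now apply sublinear_scal.
  + assert (H := sublinear_scal p (- r) u Hp ltac:(lra)).
    replace (scal (- r) u) with (opp (scal r u)) in H
      by (symmetry; exact (scal_opp_l r u)).
    rewrite p_opp in H; lra.
- apply Rle_antisym; [apply p_N |].
  assert (H1 := HpN (opp x)).
  assert (H2 := tilt_le N x (opp x) 1 HN Rle_0_1).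
  replace (scal 1 x) with x in H2 by (symmetry; exact (scal_one x)).
  rewrite plus_opp_l (sublinear_zero N HN) in H2.
  rewrite p_opp in H1; lra.
Qed.

End HahnBanach.

(** * Real and complex scalars *)

(** The facts about the scalars that let both fields be treated at once. The last one says that 1 is
    exposed in the unit disc: a splitting of 1 whose moduli cannot exceed total 1 consists of
    nonnegative reals. *)
Record real_embedding {K : AbsRing} (e : R -> K) : Prop := {
  embed_one : e 1 = one;
  embed_plus : forall r s, e (r + s) = plus (e r) (e s);
  embed_mult : forall r s, e (r * s) = mult (e r) (e s);
  abs_embed : forall r, abs (e r) = Rabs r;
  mult_comm_K : forall a b : K, mult a b = mult b a;
  abs_mult_eq : forall a b : K, abs (mult a b) = abs a * abs b;
  abs_inverse : forall a : K, 0 < abs a ->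
    exists b : K, mult b a = one /\ abs b = / abs a;
  align_phase : forall a b : K, exists u : K,
    abs u <= 1 /\ abs (plus a (mult b u)) = abs a + abs b;
  convex_split : forall (a b : K) (s t : R), plus a b = one ->
    abs a <= s -> abs b <= t -> s + t = 1 -> a = e s /\ b = e t }.

(** The dual unit ball. Unlike the sphere, it is stable under restriction to a summand and under
    multiplication by scalars of modulus at most 1. *)
Definition contractive {K : AbsRing} {V : NormedModule K} (f : V -> K) : Prop :=
  @is_linear K V (AbsRing_NormedModule K) f /\ forall v, abs (f v) <= norm v.

(** Asking only for a contraction covers [x = 0] and the zero space as well; it is applied to values
    of operators, which may vanish. *)
Definition has_norming_functionals {K : AbsRing} (e : R -> K) : Prop :=
  forall (V : NormedModule K) (x : V), exists f : V -> K,
    contractive f /\ f x = e (norm x).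

Lemma real_embedding_R : @real_embedding R_AbsRing (fun r => r).
Proof.
split; try reflexivity.
- exact Rmult_comm.
- exact Rabs_mult.
- intros a Ha; exists (/ a); split.
  + apply Rinv_l; intros ->; revert Ha; apply Rle_not_lt, Req_le, Rabs_R0.
  + apply Rabs_inv.
- intros a b; change (exists u, Rabs u <= 1 /\ Rabs (a + b * u) = Rabs a + Rabs b).
  destruct (Rle_or_lt 0 (a * b)) as [H | H].
  + exists 1; split; [rewrite Rabs_R1; lra |].
    rewrite Rmult_1_r; destruct (Rle_or_lt 0 a); destruct (Rle_or_lt 0 b);
      unfold Rabs; repeat destruct Rcase_abs; nra.
  + exists (- 1); split; [rewrite Rabs_Ropp Rabs_R1; lra |].
    unfold Rabs; repeat destruct Rcase_abs; nra.
- intros a b s t H Ha Hb Hst; change (a + b = 1) in H.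
  assert (H1 := Rle_abs a); assert (H2 := Rle_abs b).
  change (Rabs a <= s) in Ha; change (Rabs b <= t) in Hb; split; lra.
Qed.

Lemma norming_functionals_R : @has_norming_functionals R_AbsRing (fun r => r).
Proof.
intros V x.
destruct (hahn_banach V (fun v => norm v) x) as [p [p_plus [p_scal [p_le p_x]]]].
- split; [exact norm_triangle |]; intros r u Hr.
  apply (Rle_trans _ _ _ (norm_scal r u)), Req_le.
  change (Rabs r * norm u = r * norm u); rewrite Rabs_pos_eq; lra.
- assert (p_abs : forall v, Rabs (p v) <= norm v).
  { intros v; apply Rabs_le; split; [| apply p_le].
    assert (H := p_le (scal (-1) v)).
    rewrite p_scal in H; replace (norm (scal (-1) v)) with (norm v) in H;
      [lra | symmetry].
    rewrite <- (norm_opp v); apply f_equal; exact (scal_opp_one v). }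
  exists p; split; [split; [split |] |]; try assumption.
  exists 1; split; [lra |]; intros v; rewrite Rmult_1_l; apply p_abs.
Qed.

Lemma real_embedding_C : @real_embedding C_AbsRing RtoC.
Proof.
split.
- reflexivity.
- exact RtoC_plus.
- exact RtoC_mult.
- exact Cmod_R.
- exact Cmult_comm.
- exact Cmod_mult.
- intros a Ha; apply Cmod_gt_0 in Ha; exists (/ a)%C.
  split; [now apply Cinv_l | now apply Cmod_inv].
- intros a b.
  change (exists u : C, Cmod u <= 1 /\ Cmod (a + b * u) = Cmod a + Cmod b).
  destruct (Ceq_dec a 0) as [-> | Ha].
  { exists (RtoC 1); split; [rewrite Cmod_1; lra |].
    rewrite Cmult_1_r Cplus_0_l Cmod_0; ring. }
  destruct (Ceq_dec b 0) as [-> | Hb].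
  { exists (RtoC 0); split; [rewrite Cmod_0; lra |].
    rewrite Cmult_0_l Cplus_0_r Cmod_0; ring. }
  assert (Ha' := proj1 (Cmod_gt_0 a) Ha); assert (Hb' := proj1 (Cmod_gt_0 b) Hb).
  (* This makes [b * u] a positive multiple of [a], of modulus [Cmod b]. *)
  exists (a * RtoC (Cmod b / Cmod a) / b)%C; split.
  + rewrite Cmod_div; [| exact Hb].
    rewrite Cmod_mult Cmod_R Rabs_pos_eq.
    * apply Req_le; field; lra.
    * apply Rlt_le, Rdiv_lt_0_compat; lra.
  + replace (a + b * (a * RtoC (Cmod b / Cmod a) / b))%C
      with (a * RtoC (1 + Cmod b / Cmod a))%C.
    * rewrite Cmod_mult Cmod_R Rabs_pos_eq; [field; lra |].
      assert (H := Rdiv_lt_0_compat _ _ Hb' Ha'); lra.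
    * rewrite RtoC_plus; field; exact Hb.
(* Real parts are at most [s] and [t] but sum to [1 = s + t], so both bounds are equalities; a
   modulus equal to the real part leaves no imaginary part. *)
- assert (real_of_Re : forall (a : C) (s : R), Cmod a <= s -> s <= Re a -> a = RtoC s).
  { intros [a a'] s Ha Hs; simpl in Hs.
    assert (H := re_le_Cmod (a, a')); simpl in H; assert (H' := Rle_abs a).
    assert (Has : a = s) by lra.
    assert (H0 := Cmod2_alt (a, a')); simpl in H0.
    replace (Cmod (a, a')) with a in H0 by lra.
    assert (Ha' : a' = 0) by nra.
    unfold RtoC; now subst. }
  intros a b s t H Ha Hb Hst.
  assert (HRe : Re a + Re b = 1) by exact (f_equal Re H).
  assert (H1 := Rle_trans _ _ _ (Rle_abs _) (re_le_Cmod a)).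
  assert (H2 := Rle_trans _ _ _ (Rle_abs _) (re_le_Cmod b)).
  change (Cmod a <= s) in Ha; change (Cmod b <= t) in Hb.
  split; apply real_of_Re; lra.
Qed.

(** * Norming functionals over the complex numbers *)

Section RestrictScalars.

Variable V : ModuleSpace C_Ring.

Let rscal (r : R) (v : V) : V := scal (RtoC r) v.

Lemma rscal_assoc (r s : R) (v : V) : rscal r (rscal s v) = rscal (r * s) v.
Proof. unfold rscal; rewrite scal_assoc RtoC_mult; reflexivity. Qed.

Lemma rscal_distr_r (r s : R) (v : V) :
  rscal (r + s) v = plus (rscal r v) (rscal s v).
Proof.
unfold rscal; rewrite RtoC_plus.
exact (scal_distr_r (RtoC r : C_Ring) (RtoC s : C_Ring) v).
Qed.

(** A bare real module suffices: the norm enters [hahn_banach] as the sublinear functional. *)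
Definition restrict_scalars : ModuleSpace R_Ring :=
  ModuleSpace.Pack R_Ring V
    (ModuleSpace.Class R_Ring V (AbelianGroup.class V)
      (ModuleSpace.Mixin R_Ring V rscal rscal_assoc (fun v => scal_one v)
        (fun r u v => scal_distr_l (RtoC r) u v) rscal_distr_r)) V.

End RestrictScalars.

(* [f v = p v - i p(i v)] for a real-linear [p] dominated by the norm. *)
Lemma norming_functionals_C : @has_norming_functionals C_AbsRing RtoC.
Proof.
intros V x.
destruct (hahn_banach (restrict_scalars V) (fun v : V => norm v) x)
  as [p [p_plus [p_scal [p_le p_x]]]].
- split; [exact norm_triangle |]; intros r u Hr.
  apply (Rle_trans _ _ _ (@norm_scal C_AbsRing V (RtoC r) u)), Req_le.
  change (Cmod (RtoC r) * norm u = r * norm u).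
  rewrite Cmod_R Rabs_pos_eq; lra.
- change (V -> R) in (type of p).
  change (forall u v : V, p (plus u v) = p u + p v) in p_plus.
  change (forall r (u : V), p (scal (RtoC r : C_AbsRing) u) = r * p u) in p_scal.
  change (forall u : V, p u <= norm u) in p_le.
  pose (f := fun v : V => (p v, - p (scal (Ci : C_AbsRing) v)) : C).
  assert (p_cplx : forall (a b : R) (v : V), p (scal ((a, b) : C_AbsRing) v) =
    a * p v + b * p (scal (Ci : C_AbsRing) v)).
  { intros a b v; rewrite -!p_scal -p_plus scal_assoc -scal_distr_r.
    apply (f_equal (fun k : C_AbsRing => p (scal k v))).
    apply injective_projections; simpl; ring. }
  assert (f_plus : forall u v, f (plus u v) = Cplus (f u) (f v)).
  { intros u v; unfold f; rewrite scal_distr_l !p_plus.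
    apply injective_projections; simpl; ring. }
  assert (f_scal : forall (k : C_AbsRing) v, f (scal k v) = Cmult k (f v)).
  { intros [a b] v; unfold f; rewrite scal_assoc.
    replace (mult (Ci : C_AbsRing) ((a, b) : C_AbsRing))
      with ((- b, a) : C_AbsRing)
      by (apply injective_projections; simpl; ring).
    rewrite (p_cplx a b) (p_cplx (- b) a); apply injective_projections; simpl; ring. }
  assert (f_abs : forall v, Cmod (f v) <= norm v).
  { intros v; destruct (Ceq_dec (f v) 0) as [H | H].
    - rewrite H Cmod_0; apply norm_ge_0.
    - assert (H' := proj1 (Cmod_gt_0 _) H).
      (* Rotating [v] by this phase makes [f] real and nonnegative there, so its modulus is a value
         of [p]. *)
      pose (u := (RtoC (Cmod (f v)) / f v)%C : C_AbsRing).
      assert (Hu : abs u = 1).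
      { change (Cmod (RtoC (Cmod (f v)) / f v) = 1).
        rewrite Cmod_div; [| exact H]; rewrite Cmod_R Rabs_pos_eq; [field |]; lra. }
      assert (Hf : p (scal u v) = Cmod (f v)).
      { change (p (scal u v)) with (Re (f (scal u v))); rewrite f_scal; unfold u.
        replace (RtoC (Cmod (f v)) / f v * f v)%C with (RtoC (Cmod (f v)));
          [reflexivity | field; exact H]. }
      rewrite -Hf; apply (Rle_trans _ _ _ (p_le _)).
      apply (Rle_trans _ _ _ (norm_scal u v)); rewrite Hu; lra. }
  exists f; split; [split; [split |] |]; try assumption.
  + exists 1; split; [lra |]; intros v; rewrite Rmult_1_l; apply f_abs.
  + assert (H := Cmod2_alt (f x)); simpl in H.
    assert (H1 := f_abs x); assert (H2 := Cmod_ge_0 (f x)).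
    assert (H3 : p x = norm x) by exact p_x.
    apply injective_projections; simpl; [exact H3 |].
    rewrite H3 in H; assert (H4 := norm_ge_0 x); nra.
Qed.

Lemma embedding_with_norming_functionals (K : AbsRing) :
  K = R_AbsRing \/ K = C_AbsRing ->
  exists e : R -> K, real_embedding e /\ has_norming_functionals e.
Proof.
intros [-> | ->].
- exists (fun r => r); exact (conj real_embedding_R norming_functionals_R).
- exists RtoC; exact (conj real_embedding_C norming_functionals_C).
Qed.

(** * Operator norms and numerical radii *)

Section Scalars.

Variables (K : AbsRing) (e : R -> K).
Hypothesis He : real_embedding e.

(** The inequality [norm_scal], applied to the inverse of [k], gives the reverse one. *)
Lemma norm_scal_eq {V : NormedModule K} (k : K) (x : V) :
  norm (scal k x) = abs k * norm x.
Proof.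
apply Rle_antisym; [apply norm_scal |].
destruct (abs_ge_0 k) as [Hk | <-];
  [| rewrite Rmult_0_l; apply norm_ge_0].
destruct (abs_inverse e He k Hk) as [b [Hb Hb']].
assert (H := norm_scal b (scal k x)).
rewrite scal_assoc Hb scal_one Hb' in H.
apply (Rmult_le_compat_l (abs k)) in H; [| lra].
replace (abs k * (/ abs k * norm (scal k x))) with (norm (scal k x)) in H
  by (field; lra).
exact H.
Qed.

Lemma scal_embed_inv {V : NormedModule K} (r : R) (x : V) : r <> 0 ->
  scal (e r) (scal (e (/ r)) x) = x.
Proof.
intros Hr; rewrite scal_assoc -(embed_mult e He) Rinv_r; [| exact Hr].
rewrite (embed_one e He); apply scal_one.
Qed.

Lemma norm_normalized {V : NormedModule K} (x : V) : 0 < norm x ->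
  norm (scal (e (/ norm x)) x) = 1.
Proof.
intros Hx; rewrite norm_scal_eq (abs_embed e He) Rabs_pos_eq; [field; lra |].
apply Rlt_le, Rinv_0_lt_compat, Hx.
Qed.

Lemma norm_minus_scal_embed {V : NormedModule K} (r s : R) (x : V) :
  norm (minus (scal (e r) x) (scal (e s) x)) = Rabs (r - s) * norm x.
Proof.
rewrite -(abs_embed e He) -norm_scal_eq; apply f_equal.
replace (scal (e r) x) with (plus (scal (e (r - s)) x) (scal (e s) x)).
- unfold minus; now rewrite -plus_assoc plus_opp_r plus_zero_r.
- rewrite -scal_distr_r -(embed_plus e He).
  apply (f_equal (fun t => scal (e t) x)); ring.
Qed.

Lemma is_linear_plus_fun {U V : NormedModule K} (S T : U -> V) :
  is_linear S -> is_linear T -> is_linear (fun x => plus (S x) (T x)).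
Proof.
intros HS HT.
exact (is_linear_comp (fun x => (S x, T x)) (fun t => plus (fst t) (snd t))
  (is_linear_prod S T HS HT) is_linear_plus).
Qed.

Lemma is_linear_scal_fun {U V : NormedModule K} (f : U -> K) (w : V) :
  @is_linear K U (AbsRing_NormedModule K) f ->
  is_linear (fun x => scal (f x) w).
Proof.
intros Hf; exact (is_linear_comp f (fun k : K => scal k w) Hf (is_linear_scal_l w)).
Qed.

Lemma is_linear_scal_const {U V : NormedModule K} (k : K) (S : U -> V) :
  is_linear S -> is_linear (fun x => scal k (S x)).
Proof.
intros HS; exact (is_linear_comp S (fun v => scal k v) HS
  (is_linear_scal_r k (mult_comm_K e He))).
Qed.

Lemma is_linear_minus_fun {U V : NormedModule K} (S T : U -> V) :
  is_linear S -> is_linear T -> is_linear (fun x => minus (S x) (T x)).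
Proof.
intros HS HT; apply is_linear_plus_fun; [exact HS |].
exact (is_linear_comp T opp HT is_linear_opp).
Qed.

Lemma contractive_mult_r {V : NormedModule K} (f : V -> K) (k : K) :
  contractive f -> abs k <= 1 -> contractive (fun v => mult (f v) k).
Proof.
intros [Hf Hf'] Hk; split.
- exact (@is_linear_scal_fun V (AbsRing_NormedModule K) f k Hf).
- intros v; rewrite (abs_mult_eq e He).
  assert (H := Rmult_le_compat_l _ _ _ (abs_ge_0 (f v)) Hk).
  assert (H' := Hf' v); lra.
Qed.

Lemma op_norm_lub {U V : NormedModule K} (T : U -> V) (M : R) :
  (forall x, norm x <= 1 -> norm (T x) <= M) ->
  is_lub_Rbar (fun r => exists x : U, norm x <= 1 /\ r = norm (T x))
    (Finite (op_norm T)).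
Proof.
intros HM; apply (Lub_Rbar_finite _ (norm (T zero)) M).
- exists zero; split; [rewrite norm_zero; lra | reflexivity].
- intros r [x [Hx ->]]; exact (HM x Hx).
Qed.

Lemma op_norm_le {U V : NormedModule K} (T : U -> V) (c : R) :
  (forall x, norm x <= 1 -> norm (T x) <= c) -> op_norm T <= c.
Proof.
intros Hc; apply (proj2 (op_norm_lub T c Hc) (Finite c)).
intros r [x [Hx ->]]; exact (Hc x Hx).
Qed.

Lemma op_norm_ge_0 {U V : NormedModule K} (T : U -> V) :
  is_linear T -> 0 <= op_norm T.
Proof.
intros HT; destruct (linear_norm T HT) as [M [HM HTM]].
rewrite -(@norm_zero K V) -(linear_zero T HT).
apply (proj1 (op_norm_lub T M ltac:(intros x Hx; specialize (HTM x); nra))).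
exists zero; split; [rewrite norm_zero; lra | reflexivity].
Qed.

Lemma norm_le_op_norm {U V : NormedModule K} (T : U -> V) (x : U) :
  is_linear T -> norm (T x) <= op_norm T * norm x.
Proof.
intros HT; destruct (linear_norm T HT) as [M [HM HTM]].
destruct (norm_ge_0 x) as [Hx | Hx].
- rewrite -{1}(scal_embed_inv (norm x) x); [| lra].
  rewrite linear_scal; [| exact HT].
  rewrite norm_scal_eq (abs_embed e He) Rabs_pos_eq; [| lra].
  rewrite Rmult_comm; apply Rmult_le_compat_r; [lra |].
  apply (proj1 (op_norm_lub T M ltac:(intros u Hu; specialize (HTM u); nra))).
  eexists; split; [| reflexivity]; rewrite norm_normalized; lra.
- specialize (HTM x); rewrite -Hx in HTM *; lra.
Qed.

Lemma op_norm_eq {U V : NormedModule K} (T : U -> V) (c : R) (a : U) :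
  is_linear T -> (forall x, norm (T x) <= c * norm x) ->
  norm a = 1 -> c <= norm (T a) -> op_norm T = c.
Proof.
intros HT HTc Ha Hc; apply Rle_antisym.
- apply op_norm_le; intros x Hx; assert (H1 := HTc x).
  assert (H := HTc a); rewrite Ha in H; assert (H0 := norm_ge_0 (T a)); nra.
- assert (H := norm_le_op_norm T a HT); rewrite Ha in H; lra.
Qed.

Lemma dual_unit_sphere_contractive {V : NormedModule K} (f : V -> K) :
  dual_unit_sphere f -> contractive f.
Proof.
intros [Hf H1]; split; [exact Hf |]; intros v.
assert (H := @norm_le_op_norm V (AbsRing_NormedModule K) f v Hf).
unfold dual_norm in H1; rewrite H1 Rmult_1_l in H; exact H.
Qed.

Lemma contractive_dual_unit_sphere {V : NormedModule K} (f : V -> K) (x : V) :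
  contractive f -> norm x = 1 -> f x = one -> dual_unit_sphere f.
Proof.
intros [Hf Hf'] Hx Hfx; split; [exact Hf |].
apply (@op_norm_eq V (AbsRing_NormedModule K) f 1 x Hf).
- intros v; rewrite Rmult_1_l; apply Hf'.
- exact Hx.
- rewrite Hfx; change (1 <= abs (one : K)); rewrite abs_one; lra.
Qed.

Lemma contractive_states {V : NormedModule K} (x : V) (f : V -> K) :
  contractive f -> norm x = 1 -> f x = one -> states x f.
Proof.
intros Hf Hx Hfx; split; [exact Hx | split; [| exact Hfx]].
exact (contractive_dual_unit_sphere f x Hf Hx Hfx).
Qed.

(** [0 <= c] accounts for a space without states, where the supremum is [m_infty] and the radius
    takes the value 0. *)
Lemma numerical_radius_le {U : NormedModule K} (T : U -> U) (c : R) :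
  0 <= c -> (forall x f, states x f -> abs (f (T x)) <= c) ->
  numerical_radius T <= c.
Proof.
intros Hc HT; unfold numerical_radius.
match goal with |- real (Lub_Rbar ?E) <= _ => generalize (Lub_Rbar_correct E) end.
intros [_ H]; specialize (H (Finite c)); revert H.
match goal with |- context [Lub_Rbar ?E] =>
  destruct (Lub_Rbar E) as [l | |] end;
  simpl; intros H; try exact Hc.
apply H; intros r [x [f [Hxf ->]]]; exact (HT x f Hxf).
Qed.

Lemma abs_state_le {U : NormedModule K} (T : U -> U) (x : U) (f : U -> K) :
  is_linear T -> states x f -> abs (f (T x)) <= op_norm T.
Proof.
intros HT [Hx [Hf _]]; apply dual_unit_sphere_contractive in Hf.
assert (H := norm_le_op_norm T x HT); unfold unit_sphere in Hx.
rewrite Hx Rmult_1_r in H; exact (Rle_trans _ _ _ (proj2 Hf _) H).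
Qed.

Lemma abs_state_le_radius {U : NormedModule K} (T : U -> U) (x : U) (f : U -> K) :
  is_linear T -> states x f -> abs (f (T x)) <= numerical_radius T.
Proof.
intros HT Hxf.
apply (proj1 (Lub_Rbar_finite (fun r => exists (x : U) (f : U -> K),
  states x f /\ r = abs (f (T x))) (abs (f (T x))) (op_norm T)
  (ex_intro _ x (ex_intro _ f (conj Hxf eq_refl)))
  ltac:(intros r [y [g [Hyg ->]]]; exact (abs_state_le T y g HT Hyg)))).
now exists x, f.
Qed.

Lemma numerical_radius_ge_0 {U : NormedModule K} (T : U -> U) :
  0 <= numerical_radius T.
Proof.
unfold numerical_radius.
match goal with |- _ <= real (Lub_Rbar ?E) =>
  generalize (Lub_Rbar_correct E); destruct (Lub_Rbar E) as [l | |] end;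
  intros [H1 H2]; simpl; try lra.
destruct (Rle_or_lt 0 l) as [Hl | Hl]; [exact Hl |].
(* A negative supremum would force the set of moduli to be empty, and then [m_infty] is a smaller
   upper bound. *)
elim (H2 m_infty); intros r [x [f [Hxf ->]]].
assert (H := H1 _ (ex_intro _ x (ex_intro _ f (conj Hxf eq_refl)))); simpl in H.
assert (H0 := abs_ge_0 (f (T x))); lra.
Qed.

Lemma numerical_radius_triangle {U : NormedModule K} (S T : U -> U) :
  is_linear S -> is_linear T ->
  numerical_radius S <= numerical_radius T + op_norm (fun x => minus (S x) (T x)).
Proof.
intros HS HT; assert (HD := is_linear_minus_fun S T HS HT).
apply numerical_radius_le.
- apply Rplus_le_le_0_compat;
    [apply numerical_radius_ge_0 | now apply op_norm_ge_0].
- intros x f Hxf; assert (Hf := proj1 (proj1 (proj2 Hxf))).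
  replace (f (S x)) with (plus (f (T x)) (f (minus (S x) (T x)))).
  + apply (Rle_trans _ _ _ (abs_triangle _ _)), Rplus_le_compat.
    * now apply abs_state_le_radius.
    * exact (abs_state_le _ x f HD Hxf).
  + assert (H := linear_plus f Hf (T x) (minus (S x) (T x))).
    refine (eq_trans (eq_sym H) _); apply f_equal.
    unfold minus; now rewrite plus_comm -plus_assoc plus_opp_l plus_zero_r.
Qed.

(** The index only tests operators of norm 1, so [T] is divided by its norm; norm 0 is trivial. *)
Lemma op_norm_le_numerical_radius {U : NormedModule K} (T : U -> U) :
  numerical_index U = 1 -> is_linear T -> op_norm T <= numerical_radius T.
Proof.
intros HU HT; destruct (op_norm_ge_0 T HT) as [Hn | <-];
  [| apply numerical_radius_ge_0].
set (n := op_norm T) in *.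
assert (Hn' := Rinv_0_lt_compat _ Hn).
pose (T' := fun x => scal (e (/ n)) (T x)).
assert (HT' : is_linear T') by now apply is_linear_scal_const.
assert (TE : forall x, T x = scal (e n) (T' x)).
{ intros x; unfold T'; rewrite scal_embed_inv; [reflexivity | lra]. }
assert (T'_le : forall x, norm (T' x) <= / n * norm (T x)).
{ intros x; apply (Rle_trans _ _ _ (norm_scal _ _)).
  rewrite (abs_embed e He) Rabs_pos_eq; lra. }
assert (nT' : op_norm T' = 1).
{ apply Rle_antisym.
  - apply op_norm_le; intros x Hx.
    apply (Rle_trans _ _ _ (T'_le x)).
    assert (H := norm_le_op_norm T x HT); fold n in H.
    apply (Rmult_le_reg_l n); [exact Hn |].
    replace (n * (/ n * norm (T x))) with (norm (T x)) by (field; lra); nra.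
  - apply (Rmult_le_reg_l n); [exact Hn |]; rewrite Rmult_1_r.
    apply op_norm_le; intros x Hx; rewrite TE.
    apply (Rle_trans _ _ _ (norm_scal _ _)).
    rewrite (abs_embed e He) Rabs_pos_eq; [| lra].
    apply Rmult_le_compat_l; [lra |].
    assert (H := norm_le_op_norm T' x HT'); assert (H0 := op_norm_ge_0 T' HT').
    nra. }
assert (rT' : 1 <= numerical_radius T').
(* An infinite infimum would be read as 0, so the value 1 certifies a genuine lower bound. *)
{ unfold numerical_index in HU; revert HU.
  match goal with |- real (Glb_Rbar ?E) = 1 -> _ =>
    generalize (Glb_Rbar_correct E); destruct (Glb_Rbar E) end;
    simpl; intros [H _] HU; try (exfalso; lra).
  subst; apply (H (numerical_radius T')); now exists T'. }
apply (Rmult_le_compat_l n) in rT'; [| lra]; rewrite Rmult_1_r in rT'.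
apply (Rle_trans _ _ _ rT').
apply (Rmult_le_reg_l (/ n)); [exact Hn' |].
rewrite -Rmult_assoc Rinv_l; [| lra]; rewrite Rmult_1_l.
apply numerical_radius_le.
- apply Rmult_le_pos; [lra | apply numerical_radius_ge_0].
- intros x f Hxf; unfold T'.
  rewrite (linear_scal f (proj1 (proj1 (proj2 Hxf)))).
  change (abs (mult (e (/ n)) (f (T x))) <= / n * numerical_radius T).
  rewrite (abs_mult_eq e He) (abs_embed e He) Rabs_pos_eq; [| lra].
  apply Rmult_le_compat_l; [lra | now apply abs_state_le_radius].
Qed.

End Scalars.

(** * Operators on the l1-sum *)

Section L1SumOperators.

Variables (K : AbsRing) (e : R -> K).
Hypotheses (He : real_embedding e) (Hnorm : has_norming_functionals e).
Variables X Y : CompleteNormedModule K.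

Let Z := l1_sum X Y.

Definition inl1 (x : X) : Z := (x, zero).
Definition inr1 (y : Y) : Z := (zero, y).

Lemma norm_inl1 (x : X) : norm (inl1 x) = norm x.
Proof. unfold inl1; rewrite l1_sum_normE; simpl; rewrite norm_zero; ring. Qed.

Lemma norm_inr1 (y : Y) : norm (inr1 y) = norm y.
Proof. unfold inr1; rewrite l1_sum_normE; simpl; rewrite norm_zero; ring. Qed.

Lemma inl1_plus_inr1 (z : Z) : plus (inl1 (fst z)) (inr1 (snd z)) = z.
Proof.
destruct z as [x y]; unfold inl1, inr1; rewrite l1_sum_plusE; simpl.
now rewrite plus_zero_r plus_zero_l.
Qed.

Lemma is_linear_inl1 : is_linear inl1.
Proof.
split.
- intros x y; unfold inl1; rewrite l1_sum_plusE; simpl; now rewrite plus_zero_r.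
- intros k x; unfold inl1; rewrite l1_sum_scalE; simpl; now rewrite scal_zero_r.
- exists 1; split; [lra |]; intros x; rewrite norm_inl1; lra.
Qed.

Lemma is_linear_inr1 : is_linear inr1.
Proof.
split.
- intros x y; unfold inr1; rewrite l1_sum_plusE; simpl; now rewrite plus_zero_r.
- intros k x; unfold inr1; rewrite l1_sum_scalE; simpl; now rewrite scal_zero_r.
- exists 1; split; [lra |]; intros x; rewrite norm_inr1; lra.
Qed.

Lemma is_linear_fst1 : is_linear (fun z : Z => fst z).
Proof.
split; try reflexivity.
exists 1; split; [lra |]; intros z; rewrite l1_sum_normE.
assert (H := norm_ge_0 (snd z)); lra.
Qed.

Lemma is_linear_snd1 : is_linear (fun z : Z => snd z).
Proof.
split; try reflexivity.
exists 1; split; [lra |]; intros z; rewrite l1_sum_normE.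
assert (H := norm_ge_0 (fst z)); lra.
Qed.

(** The dual of an l1-sum carries the maximum norm, so two contractions always pair to a
    contraction. *)
Definition pair_functional (f : X -> K) (g : Y -> K) (z : Z) : K :=
  plus (f (fst z)) (g (snd z)).

Lemma contractive_pair_functional (f : X -> K) (g : Y -> K) :
  contractive f -> contractive g -> contractive (pair_functional f g).
Proof.
intros [Hf Hf'] [Hg Hg']; split.
- apply (@is_linear_plus_fun K Z (AbsRing_NormedModule K)).
  + exact (is_linear_comp _ _ is_linear_fst1 Hf).
  + exact (is_linear_comp _ _ is_linear_snd1 Hg).
- intros z; apply (Rle_trans _ _ _ (abs_triangle _ _)).
  rewrite l1_sum_normE; now apply Rplus_le_compat.
Qed.

Lemma functional_zero {V : NormedModule K} (f : V -> K) :
  contractive f -> f zero = zero.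
Proof. intros [Hf _]; exact (linear_zero f Hf). Qed.

(** At [(x, 0)] the component [g] ranges over the whole dual ball of [Y]; this freedom lets states
    see the full norm of the [Y]-component of an operator. *)
Lemma states_inl1 (x : X) (f : X -> K) (g : Y -> K) :
  contractive f -> contractive g -> norm x = 1 -> f x = one ->
  states (inl1 x) (pair_functional f g).
Proof.
intros Hf Hg Hx Hfx; apply (contractive_states K e He).
- now apply contractive_pair_functional.
- now rewrite norm_inl1.
- unfold pair_functional; simpl.
  now rewrite (functional_zero g Hg) plus_zero_r.
Qed.

Lemma states_inr1 (y : Y) (f : X -> K) (g : Y -> K) :
  contractive f -> contractive g -> norm y = 1 -> g y = one ->
  states (inr1 y) (pair_functional f g).
Proof.
intros Hf Hg Hy Hgy; apply (contractive_states K e He).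
- now apply contractive_pair_functional.
- now rewrite norm_inr1.
- unfold pair_functional; simpl.
  now rewrite (functional_zero f Hf) plus_zero_l.
Qed.

Lemma norming_functional {V : NormedModule K} (x : V) : norm x = 1 ->
  exists f : V -> K, contractive f /\ f x = one.
Proof.
intros Hx; destruct (Hnorm V x) as [f [Hf Hfx]]; exists f.
split; [exact Hf |]; now rewrite Hfx Hx (embed_one e He).
Qed.

Definition lift (T : X -> Y) (z : Z) : Z := inr1 (T (fst z)).

Lemma is_linear_lift (T : X -> Y) : is_linear T -> is_linear (lift T).
Proof.
intros HT; apply (is_linear_comp (fun z : Z => T (fst z)) inr1).
- exact (is_linear_comp _ _ is_linear_fst1 HT).
- exact is_linear_inr1.
Qed.

Lemma numerical_radius_lift (T : X -> Y) : is_linear T ->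
  numerical_radius (lift T) = op_norm T.
Proof.
intros HT; apply Rle_antisym.
- apply (numerical_radius_le K); [exact (op_norm_ge_0 K T HT) |].
  intros z h [Hz [Hh _]]; apply (dual_unit_sphere_contractive K e He) in Hh.
  apply (Rle_trans _ _ _ (proj2 Hh _)); unfold lift; rewrite norm_inr1.
  apply (Rle_trans _ _ _ (norm_le_op_norm K e He T (fst z) HT)).
  rewrite -[X in _ <= X]Rmult_1_r; apply Rmult_le_compat_l.
  + exact (op_norm_ge_0 K T HT).
  + unfold unit_sphere in Hz; rewrite l1_sum_normE in Hz.
    assert (H := norm_ge_0 (snd z)); lra.
- apply op_norm_le; intros x Hx.
  destruct (norm_ge_0 x) as [Hx' | Hx'].
  2: { rewrite (norm_eq_zero x); [| now symmetry].
       rewrite (linear_zero T HT) norm_zero; exact (numerical_radius_ge_0 K _). }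
  pose (a := scal (e (/ norm x)) x).
  assert (Ha : norm a = 1) by exact (norm_normalized K e He x Hx').
  destruct (norming_functional a Ha) as [f [Hf Hfa]].
  (* The state at [(a, 0)] with this [g] evaluates the lift to [norm (T a)]. *)
  destruct (Hnorm Y (T a)) as [g [Hg HgTa]].
  assert (H := abs_state_le_radius K e He (lift T) _ _ (is_linear_lift T HT)
    (states_inl1 a f g Hf Hg Ha Hfa)).
  unfold pair_functional in H; simpl in H.
  rewrite (functional_zero f Hf) plus_zero_l HgTa (abs_embed e He) Rabs_pos_eq in H;
    [| apply norm_ge_0].
  rewrite -(scal_embed_inv K e He (norm x) x); [| lra].
  fold a; rewrite linear_scal; [| exact HT].
  rewrite (norm_scal_eq K e He) (abs_embed e He) Rabs_pos_eq; [| lra].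
  assert (H0 := norm_ge_0 (T a)); nra.
Qed.

(** * Block components and attainment of the numerical radius *)

Variable S : Z -> Z.
Hypothesis HS : is_linear S.

Definition block_X (x : X) : X := fst (S (inl1 x)).
Definition block_Y (x : X) : Y := snd (S (inl1 x)).

Lemma is_linear_S_inl1 : is_linear (fun x => S (inl1 x)).
Proof. exact (is_linear_comp _ _ is_linear_inl1 HS). Qed.

Lemma is_linear_block_X : is_linear block_X.
Proof. exact (is_linear_comp _ _ is_linear_S_inl1 is_linear_fst1). Qed.

Lemma is_linear_block_Y : is_linear block_Y.
Proof. exact (is_linear_comp _ _ is_linear_S_inl1 is_linear_snd1). Qed.

(* Applied to the operators [block_X + g(block_Y) w] on [X], whose norm equals
   their numerical radius since [n(X) = 1], the bound valid at states extends
   to a functional [f] that need not be supported at [x]. *)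
Lemma blocks_le_numerical_radius (f : X -> K) (a x : X) :
  numerical_index X = 1 -> contractive f -> norm a = 1 -> f a = one ->
  abs (f (block_X x)) + norm (block_Y x) <= numerical_radius S * norm x.
Proof.
intros HX Hf Ha Hfa.
destruct (Hnorm Y (block_Y x)) as [g [Hg Hgx]].
destruct (align_phase e He (f (block_X x)) (g (block_Y x))) as [u [Hu Hfg]].
(* Since [f a = 1], [f w = u]: the phase makes the two terms of [f (V x)] add up in modulus, for the
   given [x]. *)
pose (w := scal u a).
pose (V := fun v => plus (block_X v) (scal (g (block_Y v)) w)).
assert (HV : is_linear V).
{ apply is_linear_plus_fun; [exact is_linear_block_X |].
  exact (@is_linear_scal_fun K X X (fun v => g (block_Y v)) w
    (is_linear_comp block_Y g is_linear_block_Y (proj1 Hg))). }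
assert (Hw : norm w <= 1).
{ unfold w; rewrite (norm_scal_eq K e He) Ha; lra. }
assert (rV : numerical_radius V <= numerical_radius S).
{ apply (numerical_radius_le K); [exact (numerical_radius_ge_0 K S) |].
  intros v h [Hv [Hh Hhv]]; apply (dual_unit_sphere_contractive K e He) in Hh.
  assert (Hk : abs (h w) <= 1) by exact (Rle_trans _ _ _ (proj2 Hh w) Hw).
  (* [h (V v) = h (BX v) + g (BY v) * h w] is the value on [S (v, 0)] of the functional with
     components [h] and [g * h w], the latter contractive because [|h w| <= 1]. *)
  assert (H := abs_state_le_radius K e He S _ _ HS
    (states_inl1 v h _ Hh (contractive_mult_r K e He g (h w) Hg Hk) Hv Hhv)).
  unfold V; rewrite (linear_plus h (proj1 Hh)) (linear_scal h (proj1 Hh)).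
  exact H. }
assert (nV := op_norm_le_numerical_radius K e He V HX HV).
assert (H := norm_le_op_norm K e He V x HV).
assert (HfV : f (V x) = plus (f (block_X x)) (mult (g (block_Y x)) u)).
{ unfold V, w.
  rewrite (linear_plus f (proj1 Hf)) !(linear_scal f (proj1 Hf)) Hfa.
  change (plus (f (block_X x)) (mult (g (block_Y x)) (mult u one)) =
    plus (f (block_X x)) (mult (g (block_Y x)) u)).
  now rewrite mult_one_r. }
assert (H1 := proj2 Hf (V x)).
rewrite HfV Hfg Hgx (abs_embed e He) Rabs_pos_eq in H1; [| apply norm_ge_0].
assert (H0 := norm_ge_0 x); nra.
Qed.

(** [z] is a convex combination of normalized vectors of the two summands, weighted by the norms of
    its components, and [h] is 1 at each of them. The [Y]-term contributes at most its weight times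
    the radius, so the [X]-term must contribute at least its own. *)
Lemma attaining_state_inl1 (z : Z) (h : Z -> K) :
  states z h -> numerical_radius S = abs (h (S z)) -> 0 < norm (fst z) ->
  let a := scal (e (/ norm (fst z))) (fst z) in
  let f := fun x => h (inl1 x) in
  let g := fun y => h (inr1 y) in
  contractive f /\ contractive g /\ norm a = 1 /\ f a = one /\
  numerical_radius S <= abs (plus (f (block_X a)) (g (block_Y a))).
Proof.
intros [Hz [Hh Hhz]] HSz Hx a f g.
unfold unit_sphere in Hz; rewrite l1_sum_normE in Hz.
apply (dual_unit_sphere_contractive K e He) in Hh.
assert (Hf : contractive f).
{ split; [exact (is_linear_comp _ _ is_linear_inl1 (proj1 Hh)) |].
  intros x; rewrite -norm_inl1; apply (proj2 Hh). }
assert (Hg : contractive g).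
{ split; [exact (is_linear_comp _ _ is_linear_inr1 (proj1 Hh)) |].
  intros y; rewrite -norm_inr1; apply (proj2 Hh). }
assert (hE : forall w, h w = pair_functional f g w).
{ intros w; rewrite -{1}(inl1_plus_inr1 w).
  exact (linear_plus h (proj1 Hh) (inl1 (fst w)) (inr1 (snd w))). }
assert (Ha : norm a = 1) by exact (norm_normalized K e He (fst z) Hx).
rewrite hE in Hhz.
destruct (convex_split e He _ _ _ _ Hhz (proj2 Hf (fst z)) (proj2 Hg (snd z)) Hz)
  as [Hfz Hgz].
assert (normalized : forall (V : NormedModule K) (k : V -> K) (v : V),
  contractive k -> 0 < norm v -> k v = e (norm v) ->
  k (scal (e (/ norm v)) v) = one).
{ intros V k v [Hk _] Hv Hkv; rewrite (linear_scal k Hk) Hkv.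
  change (mult (e (/ norm v)) (e (norm v)) = one).
  rewrite -(embed_mult e He) Rinv_l; [exact (embed_one e He) | lra]. }
assert (Hfa : f a = one) by exact (normalized X f (fst z) Hf Hx Hfz).
do 4 (split; [assumption |]).
assert (Hza : inl1 (fst z) = scal (e (norm (fst z))) (inl1 a)).
{ rewrite -(linear_scal _ is_linear_inl1); apply f_equal; symmetry.
  exact (scal_embed_inv K e He (norm (fst z)) (fst z) (Rgt_not_eq _ _ Hx)). }
assert (Hscal : forall (r : R) (w : Z), 0 <= r ->
  abs (h (S (scal (e r) w))) = r * abs (h (S w))).
{ intros r w Hr; rewrite (linear_scal S HS) (linear_scal h (proj1 Hh)).
  change (abs (mult (e r) (h (S w))) = r * abs (h (S w))).
  now rewrite (abs_mult_eq e He) (abs_embed e He) Rabs_pos_eq. }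
(* A zero [Y]-component cannot be normalized and is treated apart. *)
assert (Hy : abs (h (S (inr1 (snd z)))) <= norm (snd z) * numerical_radius S).
{ destruct (norm_ge_0 (snd z)) as [Hy | Hy].
  - pose (b := scal (e (/ norm (snd z))) (snd z)).
    replace (inr1 (snd z)) with (scal (e (norm (snd z))) (inr1 b)).
    + rewrite Hscal; [| lra]; apply Rmult_le_compat_l; [lra |].
      rewrite hE; apply (abs_state_le_radius K e He S _ _ HS).
      apply states_inr1; try assumption.
      * exact (norm_normalized K e He (snd z) Hy).
      * exact (normalized Y g (snd z) Hg Hy Hgz).
    + rewrite -(linear_scal _ is_linear_inr1); apply f_equal.
      exact (scal_embed_inv K e He (norm (snd z)) (snd z) (Rgt_not_eq _ _ Hy)).
  - rewrite (norm_eq_zero (snd z)); [| now symmetry].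
    rewrite (linear_zero _ is_linear_inr1) (linear_zero S HS).
    rewrite (functional_zero h Hh) abs_zero norm_zero; lra. }
assert (H : abs (h (S z)) <=
  norm (fst z) * abs (h (S (inl1 a))) + norm (snd z) * numerical_radius S).
{ rewrite -{1}(inl1_plus_inr1 z) (linear_plus S HS) (linear_plus h (proj1 Hh)).
  apply (Rle_trans _ _ _ (abs_triangle _ _)).
  apply Rplus_le_compat; [| exact Hy].
  rewrite Hza Hscal; lra. }
rewrite -HSz in H.
change (numerical_radius S <= abs (pair_functional f g (S (inl1 a)))).
rewrite -hE.
apply (Rmult_le_reg_l (norm (fst z))); [exact Hx |].
replace (norm (snd z)) with (1 - norm (fst z)) in H by lra; lra.
Qed.

End L1SumOperators.

(** * From the weak BPBp-nu of the sum to the BPBZp of the pair *)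

Lemma norm_minus_comm {K : AbsRing} {V : NormedModule K} (u v : V) :
  norm (minus u v) = norm (minus v u).
Proof. now rewrite -(norm_opp (minus v u)) opp_minus. Qed.

Theorem theorem2p4 (K : AbsRing) (hK : K = R_AbsRing \/ K = C_AbsRing)
    (X Y : CompleteNormedModule K) (eta : R -> R)
    (hX : numerical_index X = 1)
    (hXY : weak_BPBp_nu (l1_sum X Y) eta) :
  BPBZp X Y (fun eps => eta (eps / (4 + eps))).
Proof.
destruct (embedding_with_norming_functionals K hK) as [e [He Hnorm]].
intros eps Heps; set (d := eps / (4 + eps)).
assert (Hd : d * (4 + eps) = eps) by (unfold d; field; lra).
(* [d < 1 / 4] keeps [nu], [norm (fst z)] and [norm (BY a)] away from 0; [2 * d < eps] absorbs the
   two errors in [S']. *)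
assert (Hd1 : 0 < d < 1 / 4) by (split; nra).
assert (Hd2 : 2 * d < eps) by nra.
destruct (hXY d ltac:(lra)) as [Heta HZ]; split; [exact Heta |].
intros T g0 x0 HT nT Hg0 Hx0 Hbig.
apply (dual_unit_sphere_contractive K e He) in Hg0.
(* [f0] completes [g0] to a state at [(x0, 0)], on which the lift has the value [g0 (T x0)]. *)
destruct (norming_functional K e He Hnorm x0 Hx0) as [f0 [Hf0 Hfx0]].
assert (HlT := is_linear_lift K X Y T HT).
assert (rT := numerical_radius_lift K e He Hnorm X Y T HT); rewrite nT in rT.
destruct (HZ (lift K X Y T) (inl1 K X Y x0) (pair_functional K X Y f0 g0))
  as [S [z [h [HS [Hzh [HSz [HST [Hzz0 Hh]]]]]]]];
  [exact HlT | now apply (states_inl1 K e He) | exact rT | |].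
{ unfold pair_functional; simpl.
  now rewrite (functional_zero K f0 Hf0) plus_zero_l. }
set (nu := numerical_radius S) in *.
set (D := op_norm (fun w => minus (S w) (lift K X Y T w))) in *.
assert (HD := is_linear_minus_fun K _ _ HS HlT).
assert (D0 : 0 <= D) by exact (op_norm_ge_0 K _ HD).
assert (nu_close : Rabs (1 - nu) <= D).
{ assert (H1 : nu <= 1 + D)
    by (rewrite -rT; exact (numerical_radius_triangle K e He _ _ HS HlT)).
  assert (H2 : 1 <= nu + op_norm (fun w => minus (lift K X Y T w) (S w)))
    by (rewrite -rT; exact (numerical_radius_triangle K e He _ _ HlT HS)).
  assert (H3 : op_norm (fun w => minus (lift K X Y T w) (S w)) <= D).
  { apply op_norm_le; intros w Hw; rewrite norm_minus_comm.
    assert (H := norm_le_op_norm K e He _ w HD); fold D in H.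
    apply (Rle_trans _ _ _ H); rewrite -[X in _ <= X]Rmult_1_r.
    exact (Rmult_le_compat_l _ _ _ D0 Hw). }
  apply Rabs_le; lra. }
assert (Hnu : 1 - d < nu).
{ assert (H := Rle_abs (1 - nu)); lra. }
(* A single [D] controls both blocks together, since the lift sends [(x, 0)] to [(0, T x)]. *)
assert (blocks_close : forall x, norm (block_X K X Y S x) +
  norm (minus (block_Y K X Y S x) (T x)) <= D * norm x).
{ intros x; rewrite -(norm_inl1 K X Y x).
  assert (H := norm_le_op_norm K e He _ (inl1 K X Y x) HD); fold D in H.
  refine (Rle_trans _ _ _ (Req_le _ _ _) H); rewrite l1_sum_normE.
  apply (f_equal (fun t => t + norm (minus (block_Y K X Y S x) (T x)))).
  change (norm (block_X K X Y S x) = norm (minus (block_X K X Y S x) zero)).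
  now rewrite minus_zero_r. }
assert (Hz := proj1 Hzh); unfold unit_sphere in Hz; rewrite l1_sum_normE in Hz.
assert (z_close : norm (minus (fst z) x0) + norm (snd z) < d).
{ refine (Rle_lt_trans _ _ _ (Req_le _ _ _) Hzz0); rewrite l1_sum_normE.
  apply (f_equal (fun t => norm (minus (fst z) x0) + t)).
  change (norm (snd z) = norm (minus (snd z) zero)); now rewrite minus_zero_r. }
assert (Hx : 0 < norm (fst z)).
{ assert (H := norm_ge_0 (minus (fst z) x0)); lra. }
assert (Hatt := attaining_state_inl1 K e He X Y S HS z h Hzh HSz Hx).
cbv zeta in Hatt; fold nu in Hatt; revert Hatt.
set (a := scal (e (/ norm (fst z))) (fst z)).
set (f := fun x : X => h (inl1 K X Y x)); set (g := fun y : Y => h (inr1 K X Y y)).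
intros [Hf [Hg [Ha [Hfa Hnu_le]]]].
assert (Hblocks := fun x =>
  blocks_le_numerical_radius K e He Hnorm X Y S HS f a x hX Hf Ha Hfa).
fold nu in Hblocks; revert Hnu_le Hblocks blocks_close.
assert (HBX := is_linear_block_X K X Y S HS).
assert (HBY := is_linear_block_Y K X Y S HS).
set (BX := block_X K X Y S) in *; set (BY := block_Y K X Y S) in *.
intros Hnu_le Hblocks blocks_close.
assert (fBX_small : forall x, abs (f (BX x)) <= norm (BX x)) by
  (intros x; apply (proj2 Hf)).
assert (gBYa : abs (g (BY a)) <= norm (BY a)) by apply (proj2 Hg).
assert (Htri := abs_triangle (f (BX a)) (g (BY a))).
assert (Hblocks_a := Hblocks a); rewrite Ha in Hblocks_a.
assert (BXa_small : norm (BX a) <= D).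
{ assert (H := blocks_close a); rewrite Ha in H.
  assert (H' := norm_ge_0 (minus (BY a) (T a))); lra. }
assert (fBXa := fBX_small a).
(* Equality holds throughout, so [g] attains its norm at [BY a], which is
   nonzero because [BX] is small. *)
assert (gBYa_eq : abs (g (BY a)) = norm (BY a)) by lra.
assert (gBYa_pos : 0 < abs (g (BY a))) by lra.
destruct (abs_inverse e He _ gBYa_pos) as [c [Hc Hc']].
pose (y := scal c (BY a)).
assert (Hgy : g y = one).
{ unfold y; rewrite (linear_scal g (proj1 Hg)); exact Hc. }
assert (Hy : norm y = 1).
{ unfold y; rewrite (norm_scal_eq K e He) Hc' gBYa_eq; field; lra. }
destruct (align_phase e He (g (BY a)) (f (BX a))) as [u [Hu Hphase]].
pose (U := fun x => plus (BY x) (scal (f (BX x)) (scal u y))).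
pose (S' := fun x => scal (e (/ nu)) (U x)).
assert (HU : is_linear U).
{ apply is_linear_plus_fun; [exact HBY |].
  exact (@is_linear_scal_fun K X Y (fun v => f (BX v)) (scal u y)
    (is_linear_comp BX f HBX (proj1 Hf))). }
assert (HS' : is_linear S') by exact (is_linear_scal_const K e He _ U HU).
assert (tail_le : forall x, norm (scal (f (BX x)) (scal u y)) <= abs (f (BX x))).
{ intros x; rewrite (norm_scal_eq K e He) (norm_scal_eq K e He u) Hy Rmult_1_r.
  assert (H := abs_ge_0 (f (BX x))); nra. }
assert (nU : forall x, norm (U x) <= nu * norm x).
{ intros x.
  apply (Rle_trans _ _ _ (norm_triangle (BY x) (scal (f (BX x)) (scal u y)))).
  assert (H := tail_le x); assert (H' := Hblocks x); lra. }
assert (gUa : abs (g (U a)) = nu).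
{ unfold U; rewrite (linear_plus g (proj1 Hg)).
  rewrite (linear_scal g (proj1 Hg)) (linear_scal g (proj1 Hg) u) Hgy.
  change (abs (plus (g (BY a)) (mult (f (BX a)) (mult u one))) = nu).
  rewrite mult_one_r Hphase; lra. }
assert (nS' : forall x, norm (S' x) = / nu * norm (U x)).
{ intros x; unfold S'; rewrite (norm_scal_eq K e He) (abs_embed e He).
  rewrite Rabs_pos_eq; [reflexivity |].
  apply Rlt_le, Rinv_0_lt_compat; lra. }
assert (gS'a : abs (g (S' a)) = 1).
{ unfold S'; rewrite (linear_scal g (proj1 Hg)).
  change (abs (mult (e (/ nu)) (g (U a))) = 1).
  rewrite (abs_mult_eq e He) (abs_embed e He) gUa Rabs_pos_eq; [field; lra |].
  apply Rlt_le, Rinv_0_lt_compat; lra. }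
exists g, a, S'.
split; [exact (contractive_dual_unit_sphere K e He g y Hg Hy Hgy) |].
split; [exact Ha | split; [exact HS' |]].
split; [| split; [exact gS'a | split; [| split]]].
- apply (op_norm_eq K e He S' 1 a HS'); [| exact Ha |].
  + intros x; rewrite nS'; apply (Rmult_le_reg_l nu); [lra |].
    replace (nu * (/ nu * norm (U x))) with (norm (U x)) by (field; lra).
    assert (H := nU x); lra.
  + rewrite -gS'a; exact (proj2 Hg (S' a)).
- rewrite (minus_trans (fst z)).
  apply (Rle_lt_trans _ _ _
    (norm_triangle (minus a (fst z)) (minus (fst z) x0))).
  (* Normalizing moves [fst z] by [1 - norm (fst z) = norm (snd z)], so the total is bounded by the
     l1 distance from [z] to [(x0, 0)]. *)
  enough (H : norm (minus a (fst z)) = norm (snd z)) by lra.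
  rewrite -{1}(scal_one (fst z)) -(embed_one e He); unfold a.
  rewrite (norm_minus_scal_embed K e He).
  rewrite -{2}(Rabs_pos_eq (norm (fst z))); [| lra].
  rewrite -Rabs_mult Rmult_minus_distr_r Rinv_l; [| lra].
  rewrite Rabs_pos_eq; assert (H := norm_ge_0 (snd z)); lra.
- assert (Hh1 := proj1 (proj1 (proj2 Hzh))).
  assert (Hh0 : @is_linear K (l1_sum X Y) (AbsRing_NormedModule K)
    (pair_functional K X Y f0 g0))
    by exact (proj1 (contractive_pair_functional K X Y f0 g0 Hf0 Hg0)).
  assert (Hdiff := is_linear_minus_fun K _ _ Hh1 Hh0).
  refine (Rle_lt_trans _ _ _ _ (Rlt_trans _ _ _ Hh _)); [| lra].
  apply op_norm_le; intros v Hv.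
  (* [g - g0] is the restriction of the difference of the two functionals to the summand [Y]. *)
  assert (H := norm_le_op_norm K e He _ (inr1 K X Y v) Hdiff).
  assert (H' := op_norm_ge_0 K _ Hdiff).
  assert (Hgv : pair_functional K X Y f0 g0 (inr1 K X Y v) = g0 v).
  { unfold pair_functional; simpl.
    now rewrite (functional_zero K f0 Hf0) plus_zero_l. }
  cbv beta in H; rewrite Hgv norm_inr1 in H.
  apply (Rle_trans _ _ _ H); unfold dual_norm.
  rewrite -[X in _ <= X]Rmult_1_r; now apply Rmult_le_compat_l.
(* One [D] for rescaling by [/ nu], as [|1 - nu| <= D], and one for passing from [U] to [T]. *)
- apply (Rle_lt_trans _ (2 * D)); [| lra].
  apply op_norm_le; intros x Hx1.
  rewrite (minus_trans (U x)).
  apply (Rle_trans _ _ _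
    (norm_triangle (minus (S' x) (U x)) (minus (U x) (T x)))).
  assert (H1 : norm (minus (S' x) (U x)) <= D).
  { unfold S'; rewrite -{2}(scal_one (U x)) -(embed_one e He).
    rewrite (norm_minus_scal_embed K e He).
    replace (/ nu - 1) with (/ nu * (1 - nu)) by (field; lra).
    assert (Hinv := Rinv_0_lt_compat nu ltac:(lra)).
    rewrite Rabs_mult (Rabs_pos_eq (/ nu)); [| lra].
    apply (Rmult_le_reg_l nu); [lra |].
    replace (nu * (/ nu * Rabs (1 - nu) * norm (U x)))
      with (Rabs (1 - nu) * norm (U x)) by (field; lra).
    rewrite (Rmult_comm nu); apply Rmult_le_compat;
      [apply Rabs_pos | apply norm_ge_0 | exact nu_close |].
    assert (H := nU x); nra. }
  assert (H2 : norm (minus (U x) (T x)) <= D).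
  { replace (minus (U x) (T x)) with
      (plus (minus (BY x) (T x)) (scal (f (BX x)) (scal u y))).
    - apply (Rle_trans _ _ _ (norm_triangle (minus (BY x) (T x))
        (scal (f (BX x)) (scal u y)))).
      assert (H := tail_le x); assert (H' := blocks_close x).
      assert (H'' := fBX_small x); nra.
    - unfold U, minus; now rewrite -!plus_assoc (plus_comm (opp (T x))). }
  lra.
Qed.
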